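(* Let $X=(X,d,\mu)$ be a metric measure space and let $(U,\varphi)$ be a fragment-wise chart of dimension $n\in\mathbb{N}$ in $X$. For $\mu$-a.e. $x\in U$, the set of directions $$S_x(\varphi)=\left\{ \frac{(\varphi\circ\gamma)'(t)}{|(\varphi\circ\gamma)'(t)|}:\ \gamma\in\mathrm{Fr}(X),\ t\in\mathrm{dom}(\gamma),\ \gamma_t=x,\ (\varphi\circ\gamma)'(t)\text{ exists and is nonzero}\right\}\subset S^{n-1}$$ is dense in $S^{n-1}$.
   Context: A metric measure space $X=(X,d,\mu)$ is a complete separable metric space $(X,d)$ with a Borel regular measure $\mu$ that is finite on bounded sets (a Radon measure). $\mathrm{LIP}(X,\mathbb{R}^n)$ is the set of Lipschitz maps $X\to\mathbb{R}^n$. Curve fragments. A curve fragment is a bi-Lipschitz map $\gamma:\mathrm{dom}(\gamma)\to X$ from a compact set $\mathrm{dom}(\gamma)\subset\mathbb{R}$; write $\gamma_t=\gamma(t)$. $\mathrm{Fr}(X)$ is the set of curve fragments, each identified with its graph in $\mathbb{R}\times X$, and equipped with the Hausdorff metric on closed bounded subsets of $\mathbb{R}\times X$. For Lipschitz $\varphi:X\to\mathbb{R}^n$ the derivative is $(\varphi\circ\gamma)'(t)=\lim_{\mathrm{dom}(\gamma)\ni s\to t}\frac{\varphi(\gamma_s)-\varphi(\gamma_t)}{s-t}$ (at non-isolated $t\in\mathrm{dom}(\gamma)$); it exists for a.e. $t\in\mathrm{dom}(\gamma)$. Alberti representations. An Alberti representation $\mathcal{A}=\{\mu_\gamma,\mathbb{P}\}$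 of a Radon measure $\nu$ on $X$ consists of a finite measure $\mathbb{P}$ on $\mathrm{Fr}(X)$ and, for $\mathbb{P}$-a.e. $\gamma$, a finite measure $\mu_\gamma\ll\mathcal{H}^1|_{\mathrm{im}(\gamma)}$ such that for every Borel $E\subset X$ the map $\gamma\mapsto\mu_\gamma(E)$ is Borel and $\nu(E)=\int_{\mathrm{Fr}(X)}\mu_\gamma(E)\,\mathrm{d}\mathbb{P}(\gamma)$. For $v\in S^{m-1}$, $\vartheta\in(0,\infty)$, let $C(v,\vartheta)=\{w\in\mathbb{R}^m: v\cdot w>\cos\vartheta\,|w|\}$. Cones $C_1,\dots,C_k\subset\mathbb{R}^m$ are independent if $w_1,\dots,w_k$ are linearly independent whenever $w_j\in C_j$. A cone field is a map $x\mapsto\boldsymbol{C}_x=C(\boldsymbol v_x,\boldsymbol\vartheta_x)$ with $\boldsymbol v:X\to S^{m-1}$, $\boldsymbol\vartheta:X\to(0,\infty)$ Borel; cone fields are independent if they are so pointwise. For $\psi\in\mathrm{LIP}(X,\mathbb{R}^m)$, $\mathcal{A}$ is in the $\psi$-direction of $\boldsymbol C$ if $(\psi\circ\gamma)'(t)\in\boldsymbol C_{\gamma_t}$ for a.e. $t\in\mathrm{dom}(\gamma)$, for $\mathbb{P}$-a.e. $\gamma$. Alberti representations $\mathcal{A}_1,\dots,\mathcal{A}_k$ are $\psi$-independent if they are in the $\psi$-directions of independent cone fields $\boldsymbol C_1,\dots,\boldsymbol C_k$. Charts. A fragment-wise chart $(U,\varphi)$ of dimension $n$ is a Borel set $U\subset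 X$ with $\mu(U)>0$ and $\varphi\in\mathrm{LIP}(X,\mathbb{R}^n)$ such that (i) $\mu|_U$ admits $n$ $\varphi$-independent Alberti representations; (ii) if $V\subset U$ is Borel with $\mu(V)>0$ and $\mu|_V$ admits $k$ independent Alberti representations (i.e. $\psi$-independent for some $m$ and some $\psi\in\mathrm{LIP}(X,\mathbb{R}^m)$), then $k\le n$. *)

(* Defs.v *)
From HB Require Import structures.
From mathcomp Require Import all_boot all_order all_algebra.
From mathcomp Require Import all_classical all_reals all_analysis.

Set Implicit Arguments.
Unset Strict Implicit.
Unset Printing Implicit Defensive.

Import Order.TTheory GRing.Theory Num.Theory.
Import numFieldNormedType.Exports.

Local Open Scope classical_set_scope.
Local Open Scope ring_scope.

(* The library's completeType carries a base point, so that the spaces below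
   are nonempty. *)
#[short(type="completeMetricType")]
HB.structure Definition CompleteMetric (R : realType) :=
  {T of Metric R T & Complete T}.

Definition separable (T : topologicalType) :=
  exists2 D : set T, countable D & dense D.

Notation borel T := (g_sigma_algebraType (@open T)).

(* A Borel regular measure on a metric space is determined by its values on
   Borel sets, and is represented by its restriction to them. *)
Definition finite_on_bounded (R : realType) (X : completeMetricType R)
    (mu : set X -> \bar R) :=
  forall (B : set (borel X)) (x : X) (r : R),
    measurable B -> B `<=` ball x r -> (mu B < +oo)%E.

Section euclidean.
Context {R : realType}.

Definition dot n (u v : 'rV[R]_n) : R := \sum_(i < n) u 0 i * v 0 i.

(* The library norm `|u| on 'rV[R]_n is the sup norm. *)
Definition enorm n (u : 'rV[R]_n) : R := Num.sqrt (dot u u).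

Definition sphere n : set 'rV[R]_n := [set u | enorm u = 1].

Definition cone n (v : 'rV[R]_n) (theta : R) : set 'rV[R]_n :=
  [set w | cos theta * enorm w < dot v w].

Definition independent_cones k n (C : 'I_k -> set 'rV[R]_n) :=
  forall w : 'I_k -> 'rV[R]_n, (forall j, C j (w j)) ->
    row_free (\matrix_(j < k) w j).

Definition LIP (X : metricType R) n (f : X -> 'rV[R]_n) :=
  exists L : R, forall x y, enorm (f x - f y) <= L * mdist x y.

End euclidean.

Section hausdorff_measure.
Context {R : realType} (X : metricType R).
Local Open Scope ereal_scope.

(* 0 is added to the set so that the empty set has diameter 0. *)
Definition diam (A : set X) : \bar R :=
  ereal_sup (0 |` [set (mdist x y)%:E | x in A & y in A]).

(* The one-dimensional Hausdorff measure, as an outer measure. *)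
Definition hausdorff1 (A : set X) : \bar R :=
  ereal_sup [set ereal_inf [set \sum_(0 <= i <oo) diam (F i) | F in
      [set F : (set X)^nat | A `<=` \bigcup_i F i /\
                             forall i, diam (F i) <= delta%:E]]
    | delta in [set delta : R | (0 < delta)%R]].

End hausdorff_measure.

(* As usual for the Hausdorff metric, the empty fragment is excluded. *)
Record fragment (R : realType) (X : metricType R) := Fragment {
  fr_dom : set R ;
  fr_fun :> fr_dom -> X ;
  fr_dom_neq0 : fr_dom !=set0 ;
  fr_dom_compact : compact fr_dom ;
  fr_bilipschitz : exists2 L : R, 0 < L & forall s t : fr_dom,
    L^-1 * `|\val s - \val t| <= mdist (fr_fun s) (fr_fun t)
      <= L * `|\val s - \val t| }.

Section fragment_metric.
Context {R : realType} (X : metricType R).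
Implicit Types g h : fragment X.

Definition fr_graph g : set (R * X) := range (fun t : fr_dom g => (\val t, g t)).

Definition fr_im g : set X := range g.

(* The max metric on R * X; any of the usual equivalent product metrics gives
   an equivalent Hausdorff metric, hence the same Borel sets of fragments. *)
Definition graph_dist (p q : R * X) : R :=
  Num.max `|p.1 - q.1| (mdist p.2 q.2).

Definition graph_near (r : R) (A B : set (R * X)) :=
  forall a, A a -> exists2 b, B b & graph_dist a b <= r.

Definition hausdorff_dist (A B : set (R * X)) : R :=
  inf [set r | [/\ 0 <= r, graph_near r A B & graph_near r B A]].

Definition fr_dist g h : R := hausdorff_dist (fr_graph g) (fr_graph h).

Lemma fr_ext g h : fr_graph g = fr_graph h -> g = h.
Proof.
have dom_sub g1 g2 : fr_graph g1 `<=` fr_graph g2 -> fr_dom g1 `<=` fr_dom g2.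
  move=> sub x /mem_set x1.
  have [t _ [tx _]] := sub (x, g1 (exist _ x x1)) (imageT _ (exist _ x x1)).
  rewrite -tx.
  exact: set_valP.
move=> gh; have dgh : fr_dom g = fr_dom h.
  by apply/seteqP; split; apply: dom_sub; rewrite gh.
case: g h gh dgh => D f D0 Dc fL [D' f' D0' Dc' fL'] /= gh dgh.
case: D' / dgh f' D0' Dc' fL' gh => f' D0' Dc' fL' gh.
have ff' : f = f'.
  apply/funext => t.
  have : fr_graph (Fragment D0' Dc' fL') (\val t, f t) by rewrite -gh; exists t.
  by move=> [s _ [/= /val_inj -> ->]].
case: f' / ff' D0' Dc' fL' gh => D0' Dc' fL' _.
by congr Fragment; exact: Prop_irrelevance.
Qed.

Lemma graph_distxx p : graph_dist p p = 0.
Proof. by rewrite /graph_dist subrr normr0 mdistxx maxxx. Qed.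

Lemma graph_distC p q : graph_dist p q = graph_dist q p.
Proof. by rewrite /graph_dist distrC metric_sym. Qed.

Lemma graph_dist_triangle q p r :
  graph_dist p r <= graph_dist p q + graph_dist q r.
Proof.
rewrite /graph_dist ge_max; apply/andP; split.
  by rewrite (le_trans (ler_distD q.1 _ _))// lerD// le_max lexx.
by rewrite (le_trans (metric_triangle _ q.2 _))// lerD// le_max lexx orbT.
Qed.

Let admissible g h : set R := [set r |
  [/\ 0 <= r, graph_near r (fr_graph g) (fr_graph h)
    & graph_near r (fr_graph h) (fr_graph g)]].

Lemma fr_graph_bounded g p :
  exists r, forall a, fr_graph g a -> graph_dist a p <= r.
Proof.
have [L L0 gL] := fr_bilipschitz g.
have [x gx] := fr_dom_neq0 g.
pose t0 : fr_dom g := exist _ x (mem_set gx).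
have /compact_bounded[M [Mreal MP]] := @fr_dom_compact _ _ g.
have bnd s : fr_dom g s -> `|s| <= M + 1 by move=> gs; apply: MP; rewrite ?ltrDl.
exists (Num.max (2 * (M + 1)) (L * (2 * (M + 1))) + graph_dist (x, g t0) p).
move=> _ [t _ <-].
rewrite (le_trans (graph_dist_triangle (x, g t0) _ _))// lerD2r.
have tx : `|\val t - x| <= 2 * (M + 1).
  rewrite (le_trans (ler_normB _ _))// mulr_natl mulr2n lerD// bnd//.
  exact: set_valP.
rewrite /graph_dist ge_max !le_max /= tx /=.
have /andP[_ gtt0] := gL t t0; apply/orP; right.
by rewrite (le_trans gtt0)// ler_wpM2l// ltW.
Qed.

Lemma admissible_neq0 g h : admissible g h !=set0.
Proof.
have [x gx] := fr_dom_neq0 g; have [y hy] := fr_dom_neq0 h.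
pose p := (x, g (exist _ x (mem_set gx))).
pose q := (y, h (exist _ y (mem_set hy))).
have gp : fr_graph g p by exists (exist _ x (mem_set gx)).
have hq : fr_graph h q by exists (exist _ y (mem_set hy)).
have [r1 r1P] := fr_graph_bounded g q; have [r2 r2P] := fr_graph_bounded h p.
exists (Num.max 0 (Num.max r1 r2)); split; first by rewrite le_max lexx.
  by move=> a /r1P ar; exists q; rewrite ?le_max ?ar ?orbT.
by move=> a /r2P ar; exists p; rewrite ?le_max ?ar ?orbT.
Qed.

Lemma admissible_has_inf g h : has_inf (admissible g h).
Proof. by split; [exact: admissible_neq0 | exists 0 => r []]. Qed.

Lemma fr_distxx g : fr_dist g g = 0.
Proof.
apply/eqP; rewrite eq_le; apply/andP; split; last first.
  by apply: lb_le_inf; [exact: admissible_neq0 | move=> r []].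
apply: ge_inf; first by exists 0 => r [].
by split => // a ga; exists a; rewrite ?graph_distxx.
Qed.

Lemma fr_distC g h : fr_dist g h = fr_dist h g.
Proof.
by rewrite /fr_dist /hausdorff_dist; congr inf; apply/seteqP; split => r [].
Qed.

Lemma fr_dist_triangle h g k : fr_dist g k <= fr_dist g h + fr_dist h k.
Proof.
apply/ler_addgt0Pr => e e0; have e20 : 0 < e / 2 by rewrite divr_gt0.
have [r [r0 gh hg] rlt] := inf_adherent e20 (admissible_has_inf g h).
have [s [s0 hk kh] slt] := inf_adherent e20 (admissible_has_inf h k).
have near_trans u v A B C :
    graph_near u A B -> graph_near v B C -> graph_near (u + v) A C.
  move=> AB BC a /AB[b /BC[c Cc bc] ab]; exists c => //.
  by rewrite (le_trans (graph_dist_triangle b _ _))// lerD.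
apply: (@le_trans _ _ (r + s)).
  apply: ge_inf; first by exists 0 => u [].
  split; [exact: addr_ge0|exact: near_trans gh hk|].
  by rewrite addrC; exact: near_trans kh hg.
by rewrite [e]splitr addrACA lerD// ltW.
Qed.

Lemma fr_graph_closed g p :
  (forall e, 0 < e -> exists2 b, fr_graph g b & graph_dist p b < e) ->
  fr_graph g p.
Proof.
move=> pg; have [L L0 gL] := fr_bilipschitz g.
have gp1 : fr_dom g p.1.
  have /(_ p.1) : closed (fr_dom g).
    by apply: compact_closed; [exact: Rhausdorff|exact: fr_dom_compact].
  apply=> B /nbhs_ballP[e /= e0 eB].
  have [_ [t _ <-]] := pg e e0.
  rewrite /graph_dist /= gt_max => /andP[pt _].
  by exists (\val t); split; [exact: set_valP | exact: eB].
pose t0 : fr_dom g := exist _ p.1 (mem_set gp1).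
suff : mdist p.2 (g t0) = 0.
  by move=> /mdist_positivity p2; exists t0 => //=; rewrite -p2 -surjective_pairing.
apply/eqP; rewrite eq_le mdist_ge0 andbT; apply/ler_addgt0Pr => e e0.
have d0 : 0 < e / (1 + L) by rewrite divr_gt0// addr_gt0.
have [_ [t _ <-]] := pg _ d0; rewrite /graph_dist /= gt_max => /andP[pt gt].
rewrite add0r (le_trans (metric_triangle _ (g t) _))//.
have -> : e = e / (1 + L) + L * (e / (1 + L)).
  by rewrite -[X in X + _]mul1r -mulrDl mulrC divfK// gt_eqF// addr_gt0.
rewrite lerD// ?(ltW gt)//.
have /andP[_ /le_trans] := gL t t0; apply.
by rewrite ler_wpM2l ?ltW// distrC.
Qed.

Lemma fr_dist_positivity g h : fr_dist g h = 0 -> g = h.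
Proof.
have sub g1 g2 : fr_dist g1 g2 = 0 -> fr_graph g1 `<=` fr_graph g2.
  move=> d0 p gp; apply: fr_graph_closed => e e0.
  have [r [_ near12 _] rlt] := inf_adherent e0 (admissible_has_inf g1 g2).
  have [b hb pb] := near12 p gp; exists b => //.
  rewrite (le_lt_trans pb)// (lt_le_trans rlt)//.
  by rewrite -/(hausdorff_dist _ _) -/(fr_dist g1 g2) d0 add0r.
move=> d0; apply: fr_ext; apply/seteqP; split; apply: sub => //.
by rewrite fr_distC.
Qed.

HB.instance Definition _ := gen_eqMixin (fragment X).
HB.instance Definition _ := gen_choiceMixin (fragment X).
HB.instance Definition _ := @isMetric.Build R (fragment X) fr_dist
  fr_distxx fr_dist_positivity fr_distC fr_dist_triangle.

End fragment_metric.

Section fragment_pointed.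
Context {R : realType} (X : completeMetricType R).

Let point_fun (t : [set 0 : R]) : X := point.

Let point_bilipschitz : exists2 L : R, 0 < L & forall s t : [set 0 : R],
  L^-1 * `|\val s - \val t| <= mdist (point_fun s) (point_fun t)
    <= L * `|\val s - \val t|.
Proof.
exists 1 => // s t; have -> : \val s = \val t.
  by rewrite (set_valP s) (set_valP t).
by rewrite subrr normr0 !mulr0 mdistxx lexx.
Qed.

HB.instance Definition _ := isPointed.Build (fragment X)
  (Fragment (ex_intro _ 0 erefl) (@compact_set1 R 0) point_bilipschitz).

End fragment_pointed.

(* (phi \o g)'(t) exists and equals v; t^' is the punctured neighbourhood filter
   in the subspace fr_dom g. *)
Definition fr_deriv (R : realType) (X : metricType R) n (phi : X -> 'rV[R]_n)
    (g : fragment X) (t : fr_dom g) (v : 'rV[R]_n) :=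
  limit_point (fr_dom g) (\val t) /\
  (fun s : fr_dom g => (\val s - \val t)^-1 *: (phi (g s) - phi (g t)))
    @ t^' --> v.

Section charts.
Context {R : realType} {X : completeMetricType R}.

(* ar_ker g is the measure mu_g. It is only constrained for ar_P-a.e. g: a
   family defined off a Borel ar_P-null set extends to a kernel by 0. *)
Record alberti_rep (nu : set X -> \bar R) := AlbertiRep {
  ar_P : {finite_measure set (borel (fragment X)) -> \bar R} ;
  ar_ker : R.-ker (borel (fragment X)) ~> (borel X) ;
  ar_ker_ac : {ae ar_P, forall g, (ar_ker g setT < +oo)%E /\
    ar_ker g `<< (fun E : set (borel X) => hausdorff1 (E `&` fr_im g))} ;
  ar_disintegration : forall E : set (borel X), measurable E ->
    nu E = (\int[ar_P]_g ar_ker g E)%E }.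

Record cone_field n := ConeField {
  cf_axis : X -> 'rV[R]_n ;
  cf_angle : X -> R ;
  cf_axis_sphere : forall x, sphere (cf_axis x) ;
  cf_angle_gt0 : forall x, 0 < cf_angle x ;
  cf_axis_borel :
    measurable_fun setT (cf_axis : borel X -> borel 'rV[R]_n) ;
  cf_angle_borel : measurable_fun setT (cf_angle : borel X -> R) }.

Definition cone_at n (C : cone_field n) (x : X) : set 'rV[R]_n :=
  cone (cf_axis C x) (cf_angle C x).

Definition in_direction nu (A : alberti_rep nu) n (psi : X -> 'rV[R]_n)
    (C : cone_field n) :=
  {ae ar_P A, forall g : fragment X,
    {ae @lebesgue_measure R, forall s, forall t : fr_dom g, \val t = s ->
      exists2 w, fr_deriv psi t w & cone_at C (g t) w}}.

Definition independent_reps nu n (psi : X -> 'rV[R]_n) k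
    (A : 'I_k -> alberti_rep nu) :=
  exists C : 'I_k -> cone_field n,
    (forall x, independent_cones (fun j => cone_at (C j) x)) /\
    (forall j, in_direction (A j) psi (C j)).

Definition fragmentwise_chart (mu : {measure set (borel X) -> \bar R}) n
    (U : set (borel X)) (phi : X -> 'rV[R]_n) :=
  [/\ (0 < mu U)%E,
      LIP phi,
      exists mU : measurable U,
        exists A : 'I_n -> alberti_rep (mrestr mu mU), independent_reps phi A
    & forall (V : set (borel X)) (mV : measurable V), V `<=` U ->
        (0 < mu V)%E ->
        forall k m (psi : X -> 'rV[R]_m), LIP psi ->
        forall A : 'I_k -> alberti_rep (mrestr mu mV),
          independent_reps psi A -> (k <= n)%N].

Definition directions n (phi : X -> 'rV[R]_n) (x : X) : set 'rV[R]_n :=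
  [set u | exists (g : fragment X) (t : fr_dom g) (v : 'rV[R]_n),
    [/\ g t = x, fr_deriv phi t v, v != 0 & u = (enorm v)^-1 *: v]].

End charts.

(* Main.v *)
Require Import Defs.
From HB Require Import structures.
From mathcomp Require Import all_boot all_order all_algebra.
From mathcomp Require Import all_classical all_reals all_analysis.
From mathcomp Require Import measurable_realfun lra ring.

(* A fragment may be defined on a convergent sequence, so the directions at x
   are the limits of (phi y_k - phi x) / s_k with s_k -> 0, d(x, y_k) = O(s_k).
   Such points y_k are reached by zigzagging along the n independent families
   of fragments.  For an open ball O of R^n, let Z be a largest part of W (a
   bounded piece of U) on which no fragment has its phi-derivative in O, up to
   null sets.  By Lebesgue density, from almost every point of any E disjoint
   from Z one moves, at all small scales, in a direction of O while staying in
   E; this can be iterated with several balls.  The disintegration shows that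
   almost every x in W admits w_j in the j-th cone such that x avoids the set Z
   of every rational ball around w_j.  The w_j form a basis, hence every v is a
   combination sum_j a_j w_j with rational a_j up to a small error, and the
   corresponding zigzag reaches points in a direction close to v. *)

Set Implicit Arguments.
Unset Strict Implicit.
Unset Printing Implicit Defensive.

Import Order.TTheory GRing.Theory Num.Theory.
Import numFieldNormedType.Exports.

Local Open Scope classical_set_scope.
Local Open Scope ring_scope.

(** * Measures and Euclidean balls *)

Lemma measurable_bigcup_countType d (T : measurableType d) (I : countType)
    (F : I -> set T) :
  (forall i, measurable (F i)) -> measurable (\bigcup_i F i).
Proof. by apply: countable_bigcupT_measurable; exact: countableP. Qed.

Lemma negligible_bigcup_countType d (T : measurableType d) (R : realType)
    (mu : {measure set T -> \bar R}) (I : countType) (F : I -> set T) :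
  (forall i, mu.-negligible (F i)) -> mu.-negligible (\bigcup_i F i).
Proof.
move=> F0.
have H : mu.-negligible (\bigcup_k oapp F set0 (unpickle k)).
  by apply: negligible_bigcup => k; case: (unpickle k) => [i|] /=;
     [exact: F0|exact: negligible_set0].
apply: negligibleS H => x [i _ Fx]; exists (pickle i) => //.
by rewrite pickleK.
Qed.

(** Exhaustion: the supremum [s] of the measures of admissible sets is attained by a countable
    union, and adjoining any admissible [Z'] to that union cannot raise its measure, which is
    finite. *)
Lemma maximal_subset d (T : measurableType d) (R : realType)
    (mu : {measure set T -> \bar R}) (W : set T) (P : set (set T)) :
  measurable W -> (mu W < +oo)%E -> P set0 ->
  (forall F : nat -> set T, (forall k, P (F k)) -> P (\bigcup_k F k)) ->
  exists Z, [/\ measurable Z, Z `<=` W, P Z &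
    forall Z', measurable Z' -> Z' `<=` W -> P Z' -> mu (Z' `\` Z) = 0].
Proof.
move=> mW Wfin P0 PU.
pose Q Z := [/\ measurable Z, Z `<=` W & P Z].
have Q0 : Q set0 by split.
have QU (F : nat -> set T) : (forall k, Q (F k)) -> Q (\bigcup_k F k).
  move=> QF; split; [|by apply: bigcup_sub => k _; case: (QF k)|].
  - by apply: bigcupT_measurable => k; case: (QF k).
  - by apply: PU => k; case: (QF k).
pose s := ereal_sup (mu @` Q).
have muW Z : Q Z -> (mu Z <= mu W)%E.
  by move=> [mZ ZW _]; rewrite le_measure ?inE.
have sW : (s <= mu W)%E by apply: ge_ereal_sup => _ [Z /muW ? <-].
have s0 : (0 <= s)%E by apply: ereal_sup_ubound; exists set0; rewrite ?measure0.
have sfin : s \is a fin_num by rewrite ge0_fin_numE// (le_lt_trans sW).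
have ex k : exists Z, Q Z /\ (s - (k.+1%:R^-1)%:E < mu Z)%E.
  have [_ [Z QZ <-] sZ] := ub_ereal_sup_adherent
    (ltac:(by rewrite invr_gt0) : 0 < k.+1%:R^-1 :> R) sfin.
  by exists Z.
have [F FP] := choice ex.
have [mZ ZW PZ] : Q (\bigcup_k F k) by apply: QU => k; case: (FP k).
exists (\bigcup_k F k); split => // Z' mZ' Z'W PZ'.
have sZ : (s <= mu (\bigcup_k F k))%E.
  apply/lee_addgt0Pr => e e0.
  have [k ke] : exists k : nat, k.+1%:R^-1 <= e.
    exists (Num.truncn e^-1); rewrite invf_ple ?posrE//.
    by rewrite ltW// truncnS_gt.
  have [[mF _ _] /ltW sF] := FP k.
  rewrite (le_trans (y := mu (F k) + (k.+1%:R^-1)%:E)%E)//.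
    by rewrite -leeBlDr//.
  rewrite leeD ?lee_fin// le_measure ?inE//; exact: bigcup_sup.
have QZZ : Q ((\bigcup_k F k) `|` Z').
  split; [exact: measurableU|by rewrite subUset|].
  have -> : (\bigcup_k F k) `|` Z' =
      \bigcup_k (if k is 0%N then Z' else \bigcup_k F k).
    apply/seteqP; split => [x [xF|xZ]|x [[|k] _ xk]].
    - by exists 1%N.
    - by exists 0%N.
    - by right.
    - by left.
  by apply: PU => -[|k].
have : (mu ((\bigcup_k F k) `|` Z') <= mu (\bigcup_k F k))%E.
  by apply: le_trans sZ; apply: ereal_sup_ubound; exists ((\bigcup_k F k) `|` Z').
have mD : measurable (Z' `\` \bigcup_k F k) by exact: measurableD.
have -> : (\bigcup_k F k) `|` Z' = (\bigcup_k F k) `|` (Z' `\` \bigcup_k F k).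
  apply/seteqP; split => [x [|Zx]|x [|[]]]; [by left| |by left|by right].
  by have [|] := pselect ((\bigcup_k F k) x); [left|right].
rewrite measureU//; last by rewrite setDE setICA setICr setI0.
rewrite -[leRHS]adde0 leeD2lE; last first.
  by rewrite ge0_fin_numE// (le_lt_trans (muW _ _) Wfin).
by rewrite measure_le0 => /eqP.
Qed.

(** * Rational balls and continuity of the Euclidean norm *)

Section rational_balls.
Context {R : realType} {n : nat}.

Lemma ratr_dense (x e : R) : 0 < e -> exists q : rat, `|x - ratr q| < e.
Proof.
move=> e0; have /rat_in_itvoo[q] : x - e < x + e.
  by rewrite ltrBlDr -addrA ltrDl addr_gt0.
rewrite in_itv /= => /andP[q1 q2]; exists q.
by rewrite ltr_norml; apply/andP; split; lra.
Qed.

Definition rat_row (q : 'rV[rat]_n) : 'rV[R]_n := map_mx ratr q.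

Lemma rat_row_dense (x : 'rV[R]_n) (e : R) :
  0 < e -> exists q : 'rV[rat]_n, ball x e (rat_row q).
Proof.
move=> e0; have [f fP] := choice (fun j => ratr_dense (x 0 j) e0).
exists (\row_j f j); split => // i j; rewrite !mxE ord1.
exact: fP.
Qed.

(** A base of the topology indexed by a countable type, so that exceptional null sets can be
    collected over all of its members. *)
Definition rat_ball (i : 'rV[rat]_n * nat) : set 'rV[R]_n :=
  ball (rat_row i.1) i.2.+1%:R^-1.

Lemma natSinv_lt (e : R) : 0 < e -> exists k : nat, k.+1%:R^-1 < e.
Proof.
move=> e0; exists (Num.truncn e^-1); rewrite invf_plt ?posrE//.
exact: truncnS_gt.
Qed.

Lemma natSinv_gt0 (k : nat) : 0 < k.+1%:R^-1 :> R.
Proof. by rewrite invr_gt0. Qed.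

Lemma rat_ball_open i : open (rat_ball i).
Proof. by apply: ball_open; exact: natSinv_gt0. Qed.

Lemma rat_ball_basis (w : 'rV[R]_n) (O : set 'rV[R]_n) : nbhs w O ->
  exists i, rat_ball i w /\ rat_ball i `<=` O.
Proof.
move=> /nbhs_ballP[e /= e0 eO].
have [k ke] : exists k : nat, k.+1%:R^-1 < e / 2.
  by apply: natSinv_lt; rewrite divr_gt0.
have [q qw] := rat_row_dense w (natSinv_gt0 k).
exists (q, k); split; rewrite /rat_ball /=; first exact: ball_sym.
move=> y qy; apply: eO; rewrite [e]splitr.
by apply: ball_triangle (le_ball (ltW ke) qw) (le_ball (ltW ke) qy).
Qed.

Lemma normr_le_enorm (u : 'rV[R]_n) : `|u| <= enorm u.
Proof.
rewrite [leLHS]/Num.norm /= mx_normrE; apply/bigmax_leP; split => [|[i j] _ /=].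
  exact: sqrtr_ge0.
rewrite ord1 -sqrtr_sqr ler_wsqrtr// /dot (bigD1 j)//= expr2 lerDl.
by apply: sumr_ge0 => k _; rewrite -expr2 sqr_ge0.
Qed.

Lemma continuous_dot (T : topologicalType) (f g : T -> 'rV[R]_n) :
  continuous f -> continuous g -> continuous (fun x => dot (f x) (g x)).
Proof.
move=> cf cg; rewrite /dot.
apply: continuous_big => [|i _ x]; first exact: add_continuous.
apply: (@continuousM _ _ (fun x => f x 0 i) (fun x => g x 0 i)).
  apply: (continuous_comp (f := f) (g := fun u : 'rV[R]_n => u 0 i)).
    exact: cf.
  exact: coord_continuous.
apply: (continuous_comp (f := g) (g := fun u : 'rV[R]_n => u 0 i)).
  exact: cg.
exact: coord_continuous.
Qed.

Lemma enorm_continuous : continuous (@enorm R n).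
Proof.
move=> u; rewrite /enorm.
apply: (continuous_comp (f := fun u => dot u u) (g := Num.sqrt)).
  by apply: continuous_dot => x; exact: cvg_id.
exact: sqrt_continuous.
Qed.

End rational_balls.

Lemma closed_ball_compact (R : realType) n (c : 'rV[R]_n) (r : R) :
  0 < r -> compact (closed_ball c r).
Proof.
move=> r0; apply: bounded_closed_compact; last exact: closed_ball_closed.
exists (`|c| + r); split; first exact: num_real.
move=> M MM w; rewrite closed_ballE// /closed_ball_ /= => wr.
rewrite (le_trans _ (ltW MM))// -[w](subKr c).
by rewrite (le_trans (ler_normB _ _))// lerD2l.
Qed.

Lemma metric_ball_open (R : realType) (X : metricType R) (y : X) (r : R) :
  open (ball y r).
Proof.
rewrite openE => x; rewrite ballEmdist /= => yx; apply/nbhs_ballP.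
exists (r - mdist y x); first by rewrite /= subr_gt0.
move=> z; rewrite !ballEmdist /= => xz.
by rewrite (le_lt_trans (metric_triangle y x z))// -ltrBrDl.
Qed.

Section lipschitz_maps.
Context {R : realType} {X : completeMetricType R} {n : nat}.
Implicit Types phi : X -> 'rV[R]_n.

Lemma LIP_bound phi : LIP phi ->
  exists2 L : R, 0 < L & forall x y, `|phi x - phi y| <= L * mdist x y.
Proof.
move=> [L Lphi]; exists (`|L| + 1); first by rewrite ltr_wpDl.
move=> x y; rewrite (le_trans (normr_le_enorm _))// (le_trans (Lphi x y))//.
by rewrite ler_wpM2r ?mdist_ge0// (le_trans (ler_norm _))// lerDl.
Qed.

Lemma LIP_continuous phi : LIP phi -> continuous phi.
Proof.
move=> /LIP_bound[L L0 Lphi] x; apply/cvgrPdist_lt => e e0.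
apply/nbhs_ballP; exists (e / L); first by rewrite /= divr_gt0.
move=> y; rewrite /= ballEmdist /= => xy.
by rewrite (le_lt_trans (Lphi x y))// mulrC -ltr_pdivlMr.
Qed.

End lipschitz_maps.

(** * Fragments *)

Section fragments.
Context {R : realType} {X : completeMetricType R}.
Implicit Types g : fragment X.

Lemma fr_deriv_approx n (phi : X -> 'rV[R]_n) g (t : fr_dom g) (w : 'rV[R]_n)
    (e : R) : fr_deriv phi t w -> 0 < e ->
  exists2 d : R, 0 < d & forall s : fr_dom g, `|\val s - \val t| < d ->
    `|phi (g s) - phi (g t) - (\val s - \val t) *: w| <= e * `|\val s - \val t|.
Proof.
move=> [_ dphi] e0.
have /cvgrPdist_le /(_ e e0) := dphi.
move=> /nbhs_ballP[d /= d0 dP]; exists d => // s st.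
have [->|neq_st] := eqVneq s t.
  by rewrite !subrr scale0r subr0 !normr0 mulr0.
have v0 : \val s - \val t != 0.
  by rewrite subr_eq0; apply: contra_neq neq_st; exact: val_inj.
have st' : ball t d s by change (`|\val t - \val s| < d); rewrite distrC.
have H := dP s st' neq_st.
rewrite -[X in X - _](scalerKV v0) -scalerBr normrZ mulrC ler_wpM2r//.
by rewrite distrC.
Qed.

Lemma fr_lipschitz g : exists2 L : R, 0 < L &
  forall s t : fr_dom g, mdist (g s) (g t) <= L * `|\val s - \val t|.
Proof.
have [L L0 gL] := fr_bilipschitz g.
by exists L => // s t; case/andP: (gL s t).
Qed.

Lemma fr_continuous g : continuous (g : fr_dom g -> X).
Proof.
have [L L0 gL] := fr_lipschitz g.
move=> t A /nbhs_ballP[e /= e0 eA].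
apply/nbhs_ballP; exists (e / L); first by rewrite /= divr_gt0.
move=> s st; apply: eA; rewrite ballEmdist /=.
by rewrite (le_lt_trans (gL t s))// mulrC -ltr_pdivlMr.
Qed.

(** The sets with measurable preimage form a sigma-algebra. It contains the open sets, whose
    preimages are relatively open in the compact set [fr_dom g]. *)
Lemma measurable_fr_preimage g (G : set (borel X)) : measurable G ->
  measurable (\val @` (g @^-1` G) : set R).
Proof.
move=> mG; pose C := [set G : set X | measurable (\val @` (g @^-1` G) : set R)].
suff : <<s @open X >> `<=` C by apply.
have mdom : measurable (fr_dom g : set R).
  by apply: compact_measurable; exact: fr_dom_compact.
apply: smallest_sub; last first.
  move=> O oO; rewrite /C /=.
  have : open (g @^-1` O).
    by apply: open_comp => // t _; exact: fr_continuous.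
  move=> [W oW WO].
  have -> : \val @` (g @^-1` O) = fr_dom g `&` W.
    rewrite -WO; apply/seteqP; split => [_ [t Wt <-]|x [gx Wx]].
      by split => //; exact: set_valP.
    by exists (exist _ x (mem_set gx)).
  by apply: measurableI => //; exact: open_measurable.
split; rewrite /C /=.
- by rewrite preimage_set0 image_set0; exact: measurable0.
- move=> A mA; rewrite setTD.
  have -> : \val @` (g @^-1` (~` A)) = fr_dom g `\` \val @` (g @^-1` A).
    apply/seteqP; split => [_ [t At <-]|x [gx Ax]].
      split; first exact: set_valP.
      by move=> [s As /val_inj st]; apply: At; rewrite -st.
    exists (exist _ x (mem_set gx)) => //= Agx; apply: Ax.
    by exists (exist _ x (mem_set gx)).
  exact: measurableD.
- move=> F mF; rewrite preimage_bigcup image_bigcup.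
  exact: bigcupT_measurable.
Qed.

(** A Lipschitz map turns a cover by intervals into a cover by sets whose diameters are at most [L]
    times the lengths. *)
Lemma hausdorff1_image_null g (B : set (fr_dom g)) :
  (@lebesgue_measure R).-negligible (\val @` B) -> hausdorff1 (g @` B) = 0%E.
Proof.
move=> /negligible_outer_measure B0.
have [L L0 gL] := fr_lipschitz g.
have diam0 (A : set X) : (0 <= diam A)%E.
  by apply: ereal_sup_ubound; left.
apply/eqP; rewrite eq_le; apply/andP; split; last first.
  apply: (le_trans (y := ereal_inf [set \sum_(0 <= i <oo) diam (F i) | F in
      [set F : (set X)^nat | g @` B `<=` \bigcup_i F i /\
                             forall i, diam (F i) <= 1%:E]])%E).
    by apply: le_ereal_inf_tmp => _ [F _ <-]; apply: nneseries_ge0.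
  by apply: ereal_sup_ubound; exists 1 => //=.
apply: ge_ereal_sup => _ [d /= d0 <-].
apply/lee_addgt0Pr => e e0; rewrite add0e.
(* A cover of total length below [c] has images whose diameters sum to at most [Num.min d e]; this
   bounds each diameter by [d] and the whole sum by [e]. *)
pose c := Num.min d e / L.
have c0 : 0 < c by rewrite divr_gt0// lt_min d0.
have : (mu_ext (wlength idfun) (\val @` B) < c%:E)%E by rewrite B0 lte_fin.
move=> /ereal_inf_lt[_ [A [mA BA] <-] Ac].
pose F k : set X := g @` [set t | A k (\val t)].
have wge0 k : (0 <= wlength idfun (A k))%E by exact: wlength_ge0.
have diamF k : (diam (F k) <= L%:E * wlength idfun (A k))%E.
  have : ocitv (A k) by exact: mA.
  move=> /ocitvP[Ak|[[a b] /= ab Ak]].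
    apply: ge_ereal_sup => ? [->|[x [t /=]]]; last by rewrite Ak.
    by rewrite mule_ge0 ?lee_fin// ltW.
  have wAk : wlength idfun (A k) = (b - a)%:E.
    by rewrite Ak wlength_itv /= lte_fin ab EFinB.
  rewrite wAk -EFinM; apply: ge_ereal_sup => _ [->|[_ [s As <-]] [_ [t At <-]] <-].
    by rewrite lee_fin mulr_ge0 ?subr_ge0// ltW.
  rewrite lee_fin (le_trans (gL s t))// ler_wpM2l ?(ltW L0)//.
  move: As At; rewrite /= Ak /= !in_itv /= => /andP[s1 s2] /andP[t1 t2].
  by rewrite ler_norml; apply/andP; split; lra.
have sumF : (\sum_(0 <= k <oo) diam (F k) <= (Num.min d e)%:E)%E.
  apply: (le_trans (y := \sum_(0 <= k <oo) L%:E * wlength idfun (A k))%E).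
    by apply: lee_nneseries.
  rewrite nneseriesZl//.
  have -> : Num.min d e = L * c by rewrite /c mulrC divfK// gt_eqF.
  by rewrite EFinM lee_pmul2l ?fin_numE// ltW.
have Fd k : (diam (F k) <= (Num.min d e)%:E)%E.
  apply: le_trans sumF.
  by rewrite (nneseriesD1 (n := k))// leeDl//; exact: nneseries_ge0.
apply: (le_trans (y := \sum_(0 <= k <oo) diam (F k))%E).
  apply: ereal_inf_lbound; exists F => //; split.
    move=> _ [t Bt <-].
    have [k _ Ak] : (\bigcup_k A k) (\val t) by apply: BA; exists t.
    by exists k => //; exists t.
  by move=> k; rewrite (le_trans (Fd k))// lee_fin ge_min lexx.
by rewrite (le_trans sumF)// lee_fin ge_min lexx orbT.
Qed.

End fragments.

(** If the ball of radius [e * |s|] about [x + s] missed [A], then [A] would fill at most the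
    fraction [1 / (1 + e)] of the ball of radius [(1 + e) * |s|] about [x]. This fails for small [s]
    at a density point. *)
Lemma lebesgue_density_near (R : realType) (A : set R) : measurable A ->
  {ae @lebesgue_measure R, forall x, A x -> forall e, 0 < e ->
    exists2 d, 0 < d & forall s, s != 0 -> `|s| < d ->
      exists2 y, A y & `|y - (x + s)| <= e * `|s|}.
Proof.
move=> mA; have := lebesgue_density mA.
apply: filter_app; first exact: (ae_filter_ringOfSetsType (@lebesgue_measure R)).
apply: aeW => /= x; move: x.
suff near_density (x : R) : (lebesgue_measure (A `&` ball x r) *
      (lebesgue_measure (ball x r))^-1)%E @[r --> 0^'+] --> (\1_A x)%:E ->
    A x -> forall e, 0 < e -> exists2 d, 0 < d &
      forall s, s != 0 -> `|s| < d -> exists2 y, A y & `|y - (x + s)| <= e * `|s|.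
  exact: near_density.
move=> dens Ax e e0.
have c1 : (((1 + e)^-1)%:E < (\1_A x)%:E :> \bar R)%E.
  by rewrite indicE mem_set// lte_fin invf_lt1 ?addr_gt0// ltrDl.
have := dens _ (open_nbhs_nbhs (conj (@open_ereal_gt_ereal _ _) c1)).
rewrite /nbhs /= => /nbhs_ballP[d /= d0 dP].
exists (d / (1 + e)); first by rewrite divr_gt0// addr_gt0.
move=> s s0 sd; apply: contrapT => noy.
have s_gt0 : 0 < `|s| by rewrite normr_gt0.
pose r := (1 + e) * `|s|.
have r0 : 0 < r by rewrite mulr_gt0// addr_gt0.
have rd : ball 0 d r.
  by rewrite /ball /= sub0r normrN gtr0_norm// /r mulrC -ltr_pdivlMr// addr_gt0.
have {rd} := dP r rd r0.
have mb y q : measurable (ball y q : set R) by exact: measurable_ball.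
have mAb : measurable (A `&` ball x r) by exact: measurableI.
have sub : (A `&` ball x r) `|` ball (x + s) (e * `|s|) `<=` ball x r.
  move=> y [[]//|]; rewrite /ball /= => xsy.
  rewrite (_ : x - y = (x + s - y) - s); last by ring.
  rewrite (le_lt_trans (ler_normB _ _))// /r mulrDl mul1r addrC ltrD2l.
  exact: xsy.
have disj : (A `&` ball x r) `&` ball (x + s) (e * `|s|) = set0.
  apply/seteqP; split => // y [[Ay _]]; rewrite /ball /= => xsy; apply: noy.
  by exists y => //; rewrite distrC ltW.
have mball (y q : R) : 0 <= q -> lebesgue_measure (ball y q) = (q *+ 2)%:E.
  exact: lebesgue_measure_ball.
have mU : (lebesgue_measure (A `&` ball x r `|` ball (x + s)%R (e * `|s|)%R) =
    lebesgue_measure (A `&` ball x r) +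
    lebesgue_measure (ball (x + s)%R (e * `|s|)%R))%E.
  by apply: measureU => //; exact: mb.
have : (lebesgue_measure (A `&` ball x r) +
    lebesgue_measure (ball (x + s)%R (e * `|s|)%R) <=
    lebesgue_measure (ball x r))%E.
  by rewrite -mU; apply: le_measure => //; apply: mem_set;
    [apply: measurableU => //|]; exact: mb.
rewrite !mball ?(ltW r0) ?mulr_ge0 ?(ltW e0)//.
have : (lebesgue_measure (A `&` ball x r) <= (r *+ 2)%:E)%E.
  rewrite -(mball x _ (ltW r0)).
  by apply: le_measure => [||y []//]; apply: mem_set => //; exact: mb.
move=> le2.
have [m mE] : exists m, lebesgue_measure (A `&` ball x r) = m%:E.
  exists (fine (lebesgue_measure (A `&` ball x r))).
  by rewrite fineK// ge0_fin_numE ?measure_ge0// (le_lt_trans le2)// ltry.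
rewrite mE -EFinD lee_fin => le1.
rewrite inver mulrn_eq0 /= gt_eqF// -EFinM lte_fin ltr_pdivlMr ?mulrn_wgt0//.
rewrite /r -mulrnAr mulrA mulVf ?gt_eqF ?addr_gt0// mul1r.
by move: le1; rewrite /r => + lt1; lra.
Qed.

(** * Reachable directions *)

Section reachability.
Context {R : realType} {X : completeMetricType R} {n : nat}.
Implicit Types (phi : X -> 'rV[R]_n) (G Z : set X) (O : set 'rV[R]_n).

(** Steps [q] of either sign are rational so that measurability involves only countably many
    conditions. The single constant [M] bounds both the admissible step size and the speed, which
    makes the sets increase with [M]. *)
Definition reach phi G O (M : nat) : set X := [set x | forall q : rat,
  q != 0 -> `|ratr q| < M.+1%:R^-1 :> R ->
  exists y, [/\ G y, O ((ratr q)^-1 *: (phi y - phi x))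
    & mdist x y < M.+1%:R * `|ratr q|]].

Lemma measurable_open (O : set X) : open O -> measurable (O : set (borel X)).
Proof. exact: sub_sigma_algebra. Qed.

(** For a fixed step [q], the points from which some [y] in [G] is hit form an open set, whatever
    [G] is; [reach] is a countable intersection of such sets. *)
Lemma measurable_reach phi G O M : continuous phi -> open O ->
  measurable (reach phi G O M : set (borel X)).
Proof.
move=> cphi oO.
pose hit (q : rat) := \bigcup_(y in G)
  ([set x | O ((ratr q)^-1 *: (phi y - phi x))] `&` ball y (M.+1%:R * `|ratr q|)).
have ohit q : open (hit q).
  apply: bigcup_open => y _.
  apply: openI; last exact: metric_ball_open.
  apply: (open_comp (f := fun x => (ratr q)^-1 *: (phi y - phi x))) => // x _.
  apply: cvgZr; apply: cvgB; first exact: cvg_cst.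
  exact: cphi.
have -> : reach phi G O M = ~` \bigcup_q
    (if (q != 0) && (`|ratr q| < M.+1%:R^-1 :> R) then ~` hit q else set0).
  apply/seteqP; split => [x xr [q _]|x nx q q0 qM].
    case: ifPn => // /andP[q0 qM]; apply.
    have [y [Gy Oy xy]] := xr q q0 qM.
    by exists y => //; split => //; rewrite ballEmdist /= metric_sym.
  apply: contrapT => noy; apply: nx; exists q => //.
  rewrite q0 qM /= => -[y Gy [/= Oy]]; rewrite ballEmdist /= => xy; apply: noy.
  by exists y; split => //; rewrite metric_sym.
apply: measurableC; apply: bigcupT_measurable_rat => q.
case: ifP => _; last exact: measurable0.
by apply: measurableC; exact: measurable_open.
Qed.

Lemma reach_subset phi G G' O O' (M M' : nat) : G `<=` G' -> O `<=` O' ->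
  (M <= M')%N -> reach phi G O M `<=` reach phi G' O' M'.
Proof.
move=> GG OO MM x xr q q0 qM.
have [|y [Gy Oy xy]] := xr q q0.
  by rewrite (lt_le_trans qM)// lef_pV2 ?posrE// ler_nat.
exists y; split; [exact: GG|exact: OO|].
by rewrite (lt_le_trans xy)// ler_wpM2r// ler_nat.
Qed.

Definition null_deriv phi O Z := forall g : fragment X,
  (@lebesgue_measure R).-negligible
    (\val @` [set t : fr_dom g | Z (g t) /\ exists2 w, O w & fr_deriv phi t w]).

Lemma null_deriv0 phi O : null_deriv phi O set0.
Proof.
move=> g; rewrite (_ : [set t | _] = set0) ?image_set0.
  exact: negligible_set0.
by apply/seteqP; split => // t [].
Qed.

Lemma null_deriv_bigcup phi O (F : nat -> set X) :
  (forall k, null_deriv phi O (F k)) -> null_deriv phi O (\bigcup_k F k).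
Proof.
move=> F0 g.
have : (@lebesgue_measure R).-negligible (\bigcup_k (\val @`
    [set t : fr_dom g | F k (g t) /\ exists2 w, O w & fr_deriv phi t w])).
  by apply: negligible_bigcup => k; exact: F0.
apply: negligibleS => _ [t [[k _ Fk] tw] <-].
by exists k => //; exists t.
Qed.

(* If g has derivative w in O at a Lebesgue density point t of g^-1(G), then g
   meets G close to t + s for every small s, so g(t) reaches G in direction O. *)
Lemma null_deriv_unreachable phi G O : measurable (G : set (borel X)) ->
  open O -> (forall x M, G x -> ~ reach phi G O M x) -> null_deriv phi O G.
Proof.
move=> mG oO unreach g.
have := lebesgue_density_near (measurable_fr_preimage g mG).
apply: negligibleS => _ [t [Gt [w Ow dw]] <-] /= dens.
have [L L0 gL] := fr_lipschitz g.
have /nbhs_ballP[r /= r0 rO] : nbhs w O by exact: open_nbhs_nbhs.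
(* Chosen so that [e <= 1], which gives [|u| <= 2 * |s|], and so that the total error
   [e * (2 + |w|)] of the difference quotient stays below [r]. *)
pose e := r / (r + (2 + `|w|)).
have w2 : 0 < 2 + `|w| by rewrite ltr_pwDl.
have D0 : 0 < r + (2 + `|w|) by rewrite addr_gt0.
have e0 : 0 < e by rewrite divr_gt0.
have e1 : e <= 1 by rewrite /e ler_pdivrMr// mul1r lerDl ltW.
have er : e * (2 + `|w|) < r.
  by rewrite /e mulrAC ltr_pdivrMr// ltr_pM2l// ltrDr.
have [d1 d10 d1P] := dens (ex_intro2 _ _ t Gt erefl) e e0.
have [d2 d20 d2P] := fr_deriv_approx dw e0.
have [k kd] : exists k : nat, k.+1%:R^-1 < Num.min d1 (d2 / 2).
  by apply: natSinv_lt; rewrite lt_min d10 divr_gt0.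
(* [k] makes the steps small enough for both approximations, and the second term bounds the speed
   [2 * L]. *)
pose M := maxn k (Num.truncn (2 * L)).
apply: (unreach (g t) M Gt) => q q0 qM.
set s : R := ratr q in qM *.
have s0 : s != 0 by rewrite fmorph_eq0.
have {qM} : `|s| < Num.min d1 (d2 / 2).
  rewrite (lt_trans _ kd)// (lt_le_trans qM)// lef_pV2 ?posrE// ler_nat.
  by rewrite ltnS leq_maxl.
rewrite lt_min => /andP[sd1 sd2].
have [_ [t' Gt' <-] t's] := d1P s s0 sd1.
set u := \val t' - \val t.
have us : `|u - s| <= e * `|s| by rewrite /u -addrA -opprD.
have u2 : `|u| <= 2 * `|s|.
  rewrite -[u](subrK s) (le_trans (ler_normD _ _))// mulrDl mul1r lerD2r.
  by rewrite (le_trans us)// ler_piMl.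
have sgt0 : 0 < `|s| by rewrite normr_gt0.
exists (g t'); split => //.
- apply: rO; rewrite -ball_normE /= distrC.
  have -> : s^-1 *: (phi (g t') - phi (g t)) - w =
      s^-1 *: (phi (g t') - phi (g t) - u *: w + (u - s) *: w).
    by rewrite (scalerBl u s w) subrKA [in RHS]scalerBr scalerA mulVf// scale1r.
  rewrite normrZ normfV ltr_pdivrMl// mulrC.
  rewrite (le_lt_trans (ler_normD _ _))// normrZ.
  have ut : `|\val t' - \val t| < d2 by rewrite (le_lt_trans u2)//; lra.
  have := d2P t' ut; rewrite -/u => H.
  have H1 : e * `|u| <= e * (2 * `|s|) by rewrite ler_pM2l.
  have H2 : `|u - s| * `|w| <= e * `|s| * `|w| by rewrite ler_wpM2r.
  have H3 : e * (2 + `|w|) * `|s| < r * `|s| by rewrite ltr_pM2r.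
  lra.
- rewrite (le_lt_trans (gL _ _))// distrC -/u.
  rewrite (le_lt_trans (y := L * (2 * `|s|)))//; first by rewrite ler_pM2l.
  rewrite mulrA ltr_pM2r// mulrC (lt_le_trans (truncnS_gt _))// ler_nat ltnS.
  exact: leq_maxr.
Qed.

End reachability.

(** * Steering: combining displacements inside sets of positive measure *)

Section steering.
Context {R : realType} {X : completeMetricType R} {n : nat}.
Context (mu : {measure set (borel X) -> \bar R}) (phi : X -> 'rV[R]_n).
Context (phi_cont : continuous phi).
Implicit Types (V W Z E G : set (borel X)) (O : set 'rV[R]_n).

(** The target is [E] itself and [E] ranges over all subsets of [V] of positive measure, so that
    moves can be chained: the set of starting points obtained for one move serves as the target of
    another. *)
Definition steers V O := forall E, measurable E -> E `<=` V -> (0 < mu E)%E ->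
  exists (E' : set (borel X)) (M : nat),
    [/\ measurable E', E' `<=` E, (0 < mu E')%E & E' `<=` reach phi E O M].

Lemma steers_subset V O O' : O `<=` O' -> steers V O -> steers V O'.
Proof.
move=> OO VO E mE EV E0; have [E' [M [mE' EE E'0 ER]]] := VO E mE EV E0.
exists E', M; split => //; apply: subset_trans ER _.
exact: reach_subset.
Qed.

Lemma steersT V : steers V [set 0].
Proof.
move=> E mE EV E0; exists E, 0%N; split => // x Ex q q0 _; exists x; split => //.
  by rewrite subrr scaler0.
by rewrite mdistxx mul1r normr_gt0 fmorph_eq0.
Qed.

(** A zigzag: from [E2] a move in [O2] lands in [E1], and from there a move in [O1] with the same
    [q] lands in [E]; the difference quotients add up. *)
Lemma steersD V O1 O2 : steers V O1 -> steers V O2 ->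
  steers V [set u + v | u in O1 & v in O2].
Proof.
move=> V1 V2 E mE EV E0; have [E1 [M1 [mE1 EE1 E10 ER1]]] := V1 E mE EV E0.
have [E2 [M2 [mE2 EE2 E20 ER2]]] := V2 E1 mE1 (subset_trans EE1 EV) E10.
(* Its successor is [M1.+1 + M2.+1], the sum of the two speeds by the triangle inequality, and
   exceeds both step thresholds. *)
exists E2, (M1 + M2).+1; split => //; first exact: subset_trans EE1.
move=> x E2x q q0 qM.
have qlt (k : nat) : (k < (M1 + M2).+2)%N -> `|ratr q| < k.+1%:R^-1 :> R.
  by move=> kM; rewrite (lt_le_trans qM)// lef_pV2 ?posrE// ler_nat.
have [|y [E1y O2y xy]] := ER2 x E2x q q0.
  by apply: qlt; rewrite ltnS (leq_trans (leq_addl M1 M2)).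
have [|z [Ez O1z yz]] := ER1 y E1y q q0.
  by apply: qlt; rewrite ltnS (leq_trans (leq_addr M2 M1)).
exists z; split => //.
  exists ((ratr q)^-1 *: (phi z - phi y)) => //.
  exists ((ratr q)^-1 *: (phi y - phi x)) => //.
  by rewrite -scalerDr addrA subrK.
rewrite (le_lt_trans (metric_triangle x y z))//.
rewrite -addSn -addnS natrD mulrDl addrC; exact: ltrD.
Qed.

(** A step [q] with quotient in [a O] is a step [a * q] with quotient in [O]; [a] is rational so
    that [a * q] is again an admissible step. For [a = 0] one stays at the same point. *)
Lemma steersZ V O (a : rat) : O !=set0 -> steers V O ->
  steers V [set ratr a *: u | u in O].
Proof.
move=> [u0 Ou0] VO; have [->|a0] := eqVneq a 0.
  apply: steers_subset (@steersT V) => _ ->.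
  by exists u0 => //; rewrite rmorph0 scale0r.
move=> E mE EV E0; have [E' [M [mE' EE E'0 ER]]] := VO E mE EV E0.
pose m := M.+1%:R * `|ratr a| : R.
have Ma : m < (Num.truncn m).+1%:R by exact: truncnS_gt.
exists E', (Num.truncn m); split => // x E'x q q0 qM.
have aR0 : 0 < `|ratr a| :> R by rewrite normr_gt0 fmorph_eq0.
have [||y [Ey Oy xy]] := ER x E'x (a * q).
- by rewrite mulf_neq0.
- rewrite rmorphM normrM -ltr_pdivlMl// -invfM mulrC.
  by rewrite (lt_le_trans qM)// lef_pV2 ?posrE ?mulr_gt0// ltW.
exists y; split => //.
  exists ((ratr (a * q))^-1 *: (phi y - phi x)) => //.
  rewrite scalerA rmorphM invfM mulrA divff ?mul1r//.
  by rewrite fmorph_eq0.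
rewrite (lt_trans xy)// rmorphM normrM mulrA ltr_pM2r ?normr_gt0 ?fmorph_eq0//.
Qed.

Lemma steers_sum V k (O : 'I_k -> set 'rV[R]_n) : (forall j, steers V (O j)) ->
  steers V [set \sum_j u j | u in [set u | forall j, O j (u j)]].
Proof.
elim: k O => [|k IH] O VO.
  apply: steers_subset (@steersT V) => _ ->.
  by exists (fun=> 0); rewrite ?big_ord0// => -[].
have := steersD (VO ord0) (IH _ (fun j => VO (lift ord0 j))).
apply: steers_subset => _ [u0 Ou0 [_ [u Ou <-]] <-].
exists (fun j => if unlift ord0 j is Some j' then u j' else u0) => [j|].
  by case: unliftP => [j' ->|->]; [exact: Ou|].
rewrite big_ord_recl unlift_none; congr (_ + _).
by apply: eq_bigr => j _; rewrite liftK.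
Qed.

(** The part [E'] of [E] from which [E] is never reached cannot reach itself either, so
    [null_deriv_unreachable] applies to it. Being disjoint from [Z], it is null by maximality, and
    some [reach phi E O M] meets [E] in positive measure. *)
Lemma steers_maximal V W Z O : open O ->
  (forall Z', measurable Z' -> Z' `<=` W -> null_deriv phi O Z' ->
    mu (Z' `\` Z) = 0) ->
  V `<=` W `\` Z -> steers V O.
Proof.
move=> oO maxZ VWZ E mE EV E0.
have mr M : measurable (reach phi E O M : set (borel X)).
  exact: measurable_reach.
pose E' := E `\` \bigcup_M reach phi E O M.
have mE' : measurable E'.
  by apply: measurableD => //; exact: bigcupT_measurable.
have E'0 : mu E' = 0.
  rewrite -(maxZ E')//.
  - congr (mu _); apply/seteqP; split => [x E'x|x []//].
    by split => //; have [] := VWZ x (EV _ E'x.1).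
  - by move=> x [/EV /VWZ []].
  - apply: null_deriv_unreachable => // x M [Ex nr] xr; apply: nr.
    by exists M => //; apply: reach_subset xr => // y [].
have [M EM] : exists M, (0 < mu (E `&` reach phi E O M))%E.
  apply: contrapT => noM; have : mu.-negligible E.
    have : mu.-negligible (E' `|` \bigcup_M (E `&` reach phi E O M)).
      apply: negligibleU; first exact/negligibleP.
      apply: negligible_bigcup => M; apply/negligibleP; first exact: measurableI.
      apply/eqP; rewrite -measure_le0 leNgt; apply/negP => EM.
      by apply: noM; exists M.
    apply: negligibleS => x Ex.
    have [[M _ xM]|xN] := pselect ((\bigcup_M reach phi E O M) x).
      by right; exists M.
    by left.
  by move=> /negligibleP -/(_ mE) E00; rewrite E00 ltxx in E0.
exists (E `&` reach phi E O M), M; split => //; first exact: measurableI.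
Qed.

(** If the unreachable part [E] had positive measure, steering inside it would give a point of [E]
    that reaches [E], hence [setT]. *)
Lemma steers_reachable V O : measurable V -> open O -> steers V O ->
  mu (V `\` \bigcup_M reach phi setT O M) = 0.
Proof.
set E := V `\` _; move=> mV oO VO; apply/eqP; rewrite -measure_le0 leNgt; apply/negP => E0.
have mE : measurable E.
  by apply: measurableD => //; apply: bigcupT_measurable => M; exact: measurable_reach.
have [E' [M [mE' EE E'0 ER]]] := VO E mE (@subDsetl _ _ _) E0.
have [E'N|/set0P[x E'x]] := eqVneq E' set0; first by rewrite E'N measure0 ltxx in E'0.
have [_] := EE x E'x; apply; exists M => //.
exact: reach_subset (ER x E'x).
Qed.

End steering.

(** Write [v] in the basis [w] with coordinates [c]. The error splits into [(c j - a j) w j], made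
    small by the choice of [a], and [a j (w j - u j)], made small by radii chosen after [a]. The
    summand 1 in the denominators avoids division by zero. *)
Lemma rat_combination (R : realType) n (w : 'I_n -> 'rV[R]_n) (v : 'rV[R]_n)
    (e : R) : row_free (\matrix_j w j) -> 0 < e ->
  exists (a : 'I_n -> rat) (i : 'I_n -> 'rV[rat]_n * nat),
    (forall j, rat_ball (i j) (w j)) /\
    forall u, (forall j, rat_ball (i j) (u j)) ->
      `|v - \sum_j ratr (a j) *: u j| < e.
Proof.
move=> wfree e0; pose B := \matrix_j w j.
pose c := v *m invmx B.
have vE : v = \sum_j c 0 j *: w j.
  have -> : v = c *m B by rewrite mulmxKV// -row_free_unit.
  rewrite mulmx_sum_row; apply: eq_bigr => j _; congr (_ *: _).
  by apply/rowP => k; rewrite !mxE.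
pose Sw := \sum_j `|w j|.
have Sw1 : 0 < 1 + Sw by rewrite ltr_pwDl// sumr_ge0.
have d0 : 0 < e / 2 / (1 + Sw) by rewrite !divr_gt0.
have [a aP] := choice (fun j => ratr_dense (c 0 j) d0).
pose Sa := \sum_j `|ratr (a j) : R|.
have Sa1 : 0 < 1 + Sa by rewrite ltr_pwDl// sumr_ge0.
have r0 : 0 < e / 2 / (1 + Sa) by rewrite !divr_gt0.
have [i iP] := choice (fun j => rat_ball_basis (nbhsx_ballx (w j) _ r0)).
exists a, i; split => [j|u iu]; first by have [] := iP j.
have -> : v - \sum_j ratr (a j) *: u j =
    \sum_j (c 0 j - ratr (a j)) *: w j + \sum_j ratr (a j) *: (w j - u j).
  rewrite {1}vE -sumrB -big_split /=; apply: eq_bigr => j _.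
  by rewrite scalerBl scalerBr addrA subrK.
rewrite [e]splitr (le_lt_trans (ler_normD _ _))// ltr_leD//.
  apply: (@le_lt_trans _ _ (e / 2 / (1 + Sw) * Sw)).
    rewrite mulr_sumr (le_trans (ler_norm_sum _ _ _))// ler_sum// => j _.
    by rewrite normrZ ler_wpM2r// ltW.
  by rewrite mulrAC ltr_pdivrMr// ltr_pM2l ?divr_gt0// ltrDr.
apply: (@le_trans _ _ (e / 2 / (1 + Sa) * Sa)).
  rewrite mulr_sumr (le_trans (ler_norm_sum _ _ _))// ler_sum// => j _.
  rewrite normrZ mulrC ler_wpM2r//.
  have [_ /(_ _ (iu j))] := iP j.
  by rewrite -ball_normE /= => /ltW.
by rewrite mulrAC ler_pdivrMr// ler_pM2l ?divr_gt0// lerDr.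
Qed.

(** * Alberti representations and cones *)

Section alberti_null.
Context {R : realType} {X : completeMetricType R}.

(** Null parameter sets have images of zero Hausdorff measure, so almost every [ar_ker A g] vanishes
    on [N] by absolute continuity, and the disintegration integrates to zero. *)
Lemma alberti_null (nu : set X -> \bar R) (A : alberti_rep nu)
    (N : set (borel X)) : measurable N ->
  {ae ar_P A, forall g : fragment X,
    (@lebesgue_measure R).-negligible (\val @` (g @^-1` N))} -> nu N = 0%E.
Proof.
move=> mN aeN; rewrite (ar_disintegration A mN).
have ker0 : {ae ar_P A, forall g : fragment X, ar_ker A g N = 0%E}.
  have := negligibleU (ar_ker_ac A) aeN.
  apply: negligibleS => g /= nker; apply: contrapT => /not_orP[/contrapT[_ ac]].
  move=> /contrapT gN; apply: nker.
  apply: (ac N) => // B mB BN.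
  have -> : B `&` fr_im g = g @` (g @^-1` B).
    apply/seteqP; split => [x [Bx [t _ tx]]|_ [t Bt <-]].
      by exists t => //=; rewrite tx.
    by split => //; exists t.
  apply: hausdorff1_image_null; apply: negligibleS gN.
  by apply: image_subset => t; exact: BN.
rewrite (ge0_ae_eq_integral (g := cst 0%E)) ?integral0//.
- exact: (measurable_kernel (ar_ker A) N mN).
- by move: ker0; apply: negligibleS => g /=; apply: contra_not => + _.
Qed.

End alberti_null.

(** * Exhausting cones by rational balls, measurably in the base point *)

Section cone_fields.
Context {R : realType} {X : completeMetricType R} {n : nat}.
Implicit Types (C : cone_field (R := R) (X := X) n).

Definition inner_ball C (i : 'rV[rat]_n * nat) : set X :=
  [set x | forall q : 'rV[rat]_n, rat_ball i (rat_row (R := R) q) ->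
    cos (cf_angle C x) * enorm (rat_row (R := R) q) + i.2.+1%:R^-1
      <= dot (cf_axis C x) (rat_row q)].

(** Closed balls of half the radius are compact, and those with [inner_ball C i x] still cover the
    cone at [x]. *)
Definition half_ball (i : 'rV[rat]_n * nat) : set 'rV[R]_n :=
  closed_ball (rat_row i.1) (i.2.+1%:R^-1 / 2).

Lemma half_ball_subset i : half_ball i `<=` rat_ball i.
Proof.
move=> w; rewrite /half_ball closed_ballE ?divr_gt0//.
rewrite /closed_ball_ /rat_ball -ball_normE /= => /le_lt_trans; apply.
by rewrite ltr_pdivrMr// ltr_pMr ?ltr1n.
Qed.

Lemma half_ball_compact i : compact (half_ball i).
Proof. by apply: closed_ball_compact; rewrite divr_gt0. Qed.

Definition cone_gap C x (w : 'rV[R]_n) : R :=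
  dot (cf_axis C x) w - cos (cf_angle C x) * enorm w.

Lemma cone_gap_continuous C x : continuous (cone_gap C x).
Proof.
have cdot : continuous (fun u : 'rV[R]_n => dot (cf_axis C x) u).
  by apply: continuous_dot; [exact: cst_continuous|move=> u; exact: cvg_id].
move=> w; apply: (continuousB (cdot w)).
by apply: continuousM; [exact: cst_continuous|exact: enorm_continuous].
Qed.

(** If [cone_gap] were nonpositive at [w], by continuity it would be below the margin at a rational
    vector of the ball close to [w]. *)
Lemma inner_ball_cone C x i w : inner_ball C i x -> rat_ball i w ->
  cone_at C x w.
Proof.
move=> xi iw; rewrite /cone_at /cone /= -subr_gt0 ltNge; apply/negP => gap.
have k0 : 0 < i.2.+1%:R^-1 :> R by [].
have gap_near := @cvgr_lt _ _ (nbhs w) _ (cone_gap C x) _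
  (@cone_gap_continuous C x w) _ (le_lt_trans gap k0).
have i_near : nbhs w (rat_ball i).
  by apply: open_nbhs_nbhs; split => //; exact: rat_ball_open.
have /nbhs_ballP[e1 /= e10 e1B] := i_near.
have /nbhs_ballP[e2 /= e20 e2B] := gap_near (nbhs_filter w).
have e0 : 0 < Num.min e1 e2 by rewrite lt_min e10.
have [q wq] := rat_row_dense w e0.
have iq : rat_ball i (rat_row q : 'rV[R]_n).
  by apply: e1B; apply: le_ball wq; rewrite ge_min lexx.
have : cone_gap C x (rat_row q) < i.2.+1%:R^-1.
  by apply: e2B; apply: le_ball wq; rewrite ge_min lexx orbT.
rewrite ltNge => /negP; apply.
by have := xi q iq; rewrite /cone_gap lerBrDl.
Qed.

Lemma cone_inner_ball C x w : cone_at C x w ->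
  exists i, half_ball i w /\ inner_ball C i x.
Proof.
rewrite /cone_at /cone /= -subr_gt0 -/(cone_gap C x w) => gap0.
have gap2 : cone_gap C x w / 2 < cone_gap C x w.
  by rewrite ltr_pdivrMr// ltr_pMr ?ltr1n.
have := @cvgr_gt _ _ (nbhs w) _ (cone_gap C x) _
  (@cone_gap_continuous C x w) _ gap2.
move=> /(_ (nbhs_filter w)) /nbhs_ballP[e /= e0 eB].
(* The first bound keeps the ball within distance [e] of [w], where the gap exceeds half of its
   value at [w]; the second puts the margin below that half. *)
have [k] : exists k : nat, k.+1%:R^-1 < Num.min (e / 2) (cone_gap C x w / 2).
  by apply: natSinv_lt; rewrite lt_min !divr_gt0.
rewrite lt_min => /andP[ke kgap].
have k20 : 0 < k.+1%:R^-1 / 2 :> R by rewrite divr_gt0.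
have [q wq] := rat_row_dense w k20.
exists (q, k); split.
  rewrite /half_ball closed_ballE// /closed_ball_ /= distrC ltW//.
  by move: wq; rewrite -ball_normE.
move=> q' qq'; rewrite -lerBrDl -/(cone_gap C x (rat_row q')).
rewrite ltW// (lt_trans kgap)//; apply: eB; rewrite [e]splitr.
apply: ball_triangle (le_ball _ wq) (le_ball (ltW ke) qq').
by rewrite (le_trans _ (ltW ke))// ler_pdivrMr// ler_peMr ?ler1n.
Qed.

Lemma continuous_borel_measurable (f : 'rV[R]_n -> R) : continuous f ->
  measurable_fun setT (f : borel 'rV[R]_n -> R).
Proof.
move=> cf; apply: (measurability _ (RGenOpens.measurableE R)).
move=> _ [_ [a [b ->] <-]]; rewrite setTI; apply: sub_sigma_algebra.
by apply: open_comp => [u _|]; [exact: cf|exact: interval_open].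
Qed.

Lemma measurable_inner_ball C i : measurable (inner_ball C i : set (borel X)).
Proof.
pose D (q : 'rV[rat]_n) : set (borel X) :=
  [set x | cos (cf_angle C x) * enorm (rat_row (R := R) q) + i.2.+1%:R^-1
             <= dot (cf_axis C x) (rat_row q)].
have mD q : measurable (D q).
  rewrite -[D q]setTI; apply: measurable_fun_le => //.
    apply: measurable_funD => //; apply: measurable_funM => //.
    apply: (measurableT_comp _ (cf_angle_borel C)).
    by apply: continuous_measurable_fun; exact: continuous_cos.
  have cdot : continuous (fun u : 'rV[R]_n => dot u (rat_row q)).
    by apply: continuous_dot; [move=> u; exact: cvg_id|exact: cst_continuous].
  exact: (measurableT_comp (continuous_borel_measurable cdot) (cf_axis_borel C)).
have -> : inner_ball C i = ~` \bigcup_q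
    (if `[< rat_ball i (rat_row (R := R) q) >] then ~` D q else set0).
  apply/seteqP; split => [x xi [q _]|x nx q iq].
    by case: asboolP => // iq; apply; exact: xi.
  apply: contrapT => nD; apply: nx; exists q => //.
  by rewrite asboolT.
apply: measurableC; apply: measurable_bigcup_countType => q.
by case: ifP => _; [exact: measurableC|exact: measurable0].
Qed.

End cone_fields.

(** * From independent cone fields to reachability in every rational ball *)

Section chart_directions.
Context {R : realType} {X : completeMetricType R} {n : nat}.
Context (mu : {measure set (borel X) -> \bar R}) (phi : X -> 'rV[R]_n).
Context (W : set (borel X)) (mW : measurable W).
Context (Z : 'rV[rat]_n * nat -> set (borel X)).
Context (mZ : forall i, measurable (Z i)).
Context (Znull : forall i, null_deriv phi (rat_ball i) (Z i)).

(* The points at which, by compactness of half balls, every vector of the cone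
   lies in some rat_ball i with x in Z i. *)
Definition cone_null (C : cone_field n) : set (borel X) :=
  [set x | W x /\ forall i, inner_ball C i x ->
    exists2 s : seq ('rV[rat]_n * nat),
      half_ball (R := R) i `<=` [set w | exists2 m, m \in s & rat_ball m w] &
      forall m, m \in s -> Z m x].

(** Finite sequences of indices are countable and the covering condition on [s] does not involve
    [x], so only countable set operations on the Borel sets [W], [Z m] and [inner_ball C i]
    occur. *)
Lemma measurable_cone_null C : measurable (cone_null C).
Proof.
pose B i := \bigcup_(s : seq ('rV[rat]_n * nat))
  (if `[< half_ball (R := R) i `<=` [set w | exists2 m, m \in s & rat_ball m w] >]
   then [set x | forall m, m \in s -> Z m x] else set0).
have mB i : measurable (B i).
  apply: measurable_bigcup_countType => s.
  case: ifP => _; last exact: measurable0.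
  have -> : [set x | forall m, m \in s -> Z m x] =
      ~` \bigcup_(m : 'rV[rat]_n * nat) (if m \in s then ~` Z m else set0).
    apply/seteqP; split => [x xs [m _]|x nx m ms].
      by case: ifP => // /xs Zx; apply.
    by apply: contrapT => nZ; apply: nx; exists m => //; rewrite ms.
  apply: measurableC; apply: measurable_bigcup_countType => m.
  by case: ifP => _; [exact: measurableC|exact: measurable0].
have -> : cone_null C = W `&` ~` \bigcup_i (inner_ball C i `\` B i).
  apply/seteqP; split => x [Wx xi]; split => //.
    move=> [i _ [/xi[s sc sZ]]]; apply; exists s => //.
    by rewrite asboolT.
  move=> i ix; apply: contrapT => noB; apply: xi; exists i => //; split => //.
  move=> [s _]; case: asboolP => // sc sZ; apply: noB.
  by exists s.
apply: measurableI => //; apply: measurableC.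
apply: measurable_bigcup_countType => i.
by apply: measurableD => //; exact: measurable_inner_ball.
Qed.

(** Along almost every fragment the derivative lies in the cone almost everywhere. At a point of
    [cone_null C] it then lies in some [rat_ball m] with the point in [Z m], which happens only on a
    null set of parameters. *)
Lemma cone_null_null (nu : set X -> \bar R) (A : alberti_rep nu)
    (C : cone_field n) : in_direction A phi C -> nu (cone_null C) = 0%E.
Proof.
move=> AC; apply: (alberti_null (A := A)); first exact: measurable_cone_null.
move: AC; apply: negligibleS => g /= nN dg; apply: nN.
have H : (@lebesgue_measure R).-negligible (\bigcup_m (\val @`
    [set t : fr_dom g | Z m (g t) /\
       exists2 w, rat_ball (R := R) m w & fr_deriv phi t w])).
  by apply: negligible_bigcup_countType => m; exact: Znull.
have := negligibleU dg H; apply: negligibleS => _ [t [Wt tN] <-].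
have [|nd] := pselect (forall t0 : fr_dom g, \val t0 = \val t ->
      exists2 w, fr_deriv phi t0 w & cone_at C (g t0) w); last by left.
move=> /(_ t erefl)[w dw Cw]; right.
have [i [iw ix]] := cone_inner_ball Cw.
have [s sc sZ] := tN i ix; have [m ms mw] := sc w iw.
by exists m => //; exists t => //; split; [exact: sZ|exists w].
Qed.

(** Otherwise the balls [rat_ball m] with [Z m x] cover the cone, and a finite subcover of each
    compact half ball puts [x] in [cone_null C]. *)
Lemma cone_null_direction (C : cone_field n) x : W x -> ~ cone_null C x ->
  exists2 w, cone_at C x w & forall m, rat_ball m w -> ~ Z m x.
Proof.
move=> Wx nN; apply: contrapT => noW; apply: nN; split => // i ix.
have := @half_ball_compact R n i; rewrite compact_cover.
move=> /(_ _ [set m | Z m x] (fun m => rat_ball (R := R) m)).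
case.
- by move=> m _; exact: rat_ball_open.
- move=> w iw; apply: contrapT => nw; apply: noW; exists w.
    exact: inner_ball_cone ix (half_ball_subset iw).
  by move=> m mw Zm; apply: nw; exists m.
move=> D DZ Dcov; exists (finmap.enum_fset D).
  by move=> w /Dcov[m mD mw]; exists m.
by move=> m /DZ /set_mem.
Qed.

Context (phi_cont : continuous phi).
Context (Zmax : forall i Z', measurable Z' -> Z' `<=` W ->
  null_deriv phi (rat_ball (R := R) i) Z' -> mu (Z' `\` Z i) = 0%E).

(** Outside the null sets [cone_null (C j)], a point lies in some [V k] whose balls [k j] combine
    rationally into the ball [i]; such a [V k] steers into [i], and only countably many [k]
    occur. *)
Lemma unreachable_null (C : 'I_n -> cone_field n) :
  (forall x, independent_cones (fun j => cone_at (C j) x)) ->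
  (forall j, mu (cone_null (C j)) = 0%E) ->
  forall i, mu (W `\` \bigcup_M reach phi setT (rat_ball i) M) = 0%E.
Proof.
move=> indC C0 i; pose V (k : {ffun 'I_n -> 'rV[rat]_n * nat}) : set (borel X) :=
  W `\` \bigcup_j Z (k j).
pose F := \bigcup_M (reach phi setT (rat_ball i) M : set (borel X)).
have mV k : measurable (V k).
  by apply: measurableD => //; exact: measurable_bigcup_countType.
have mF : measurable F.
  by apply: bigcupT_measurable => M; apply: measurable_reach => //; exact: rat_ball_open.
have H1 : mu.-negligible (\bigcup_j cone_null (C j)).
  apply: negligible_bigcup_countType => j; apply/negligibleP.
    exact: measurable_cone_null.
  exact: C0.
have H2 : mu.-negligible (\bigcup_k
    (if `[< steers mu phi (V k) (rat_ball i) >] then V k `\` F else set0)).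
  apply: negligible_bigcup_countType => k; case: asboolP => [kV|_].
    apply/negligibleP; first exact: measurableD.
    by apply: steers_reachable => //; exact: rat_ball_open.
  exact: negligible_set0.
apply/negligibleP; first exact: measurableD.
apply: negligibleS (negligibleU H1 H2) => x [Wx nFx].
have [|nC] := pselect ((\bigcup_j cone_null (C j)) x); first by left.
right.
have dir j : exists w, cone_at (C j) x w /\ forall m, rat_ball m w -> ~ Z m x.
  have [|w Cw wZ] := @cone_null_direction (C j) x Wx.
    by move=> jx; apply: nC; exists j.
  by exists w.
have [w wP] := choice dir.
have wfree : row_free (\matrix_j w j) by apply: (indC x) => j; case: (wP j).
have e0 : 0 < i.2.+1%:R^-1 :> R by [].
(* The centre of the ball [i] is the vector to approximate and its radius is the allowed error. *)
have [a [k [kw ka]]] := rat_combination (rat_row i.1) wfree e0.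
exists (finfun k) => //; case: asboolP => [_|nV].
  split => //; split => // -[j _]; rewrite ffunE => Zx.
  by have [_ /(_ _ (kw j))] := wP j.
exfalso; apply: nV; pose O j := [set ratr (a j) *: u | u in rat_ball (R := R) (k j)].
have OV j : steers mu phi (V (finfun k)) (O j).
  apply: steersZ; first by exists (w j).
  apply: (@steers_maximal _ _ _ _ _ _ _ W (Z (k j))) => //.
  - exact: rat_ball_open.
  - exact: Zmax.
  - move=> y [Wy nZ]; split => // Zy; apply: nZ.
    by exists j => //; rewrite ffunE.
apply: steers_subset (steers_sum OV) => _ [u Ou <-].
have [u' u'P] := choice (fun j => let: ex_intro2 b p q := Ou j in
  ex_intro (fun b => rat_ball (k j) b /\ ratr (a j) *: b = u j) b (conj p q)).
rewrite /rat_ball -ball_normE /=.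
have -> : \sum_j u j = \sum_j ratr (a j) *: u' j.
  by apply: eq_bigr => j _; case: (u'P j).
by apply: ka => j; case: (u'P j).
Qed.

End chart_directions.

(** * Fragments supported on sequences *)

Section sequence_fragments.
Context {R : realType} {X : completeMetricType R}.
Context (x : X) (z : nat -> X) (t : nat -> R) (a b : R).
Context (a0 : 0 < a) (b0 : 0 < b) (t0 : forall j, 0 < t j).
Context (tS2 : forall j, t j.+1 <= t j / 2).
Context (tS : forall j, 2 * b * t j.+1 <= a * t j).
Context (t_inv : forall j, t j <= j.+1%:R^-1).
Context (xz : forall j, a * t j <= mdist x (z j) <= b * t j).

Lemma seq_param_le j l : (j <= l)%N -> t l <= t j.
Proof.
elim: l => [|l IH]; first by rewrite leqn0 => /eqP ->.
rewrite leq_eqVlt ltnS => /orP[/eqP <-//|/IH].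
by apply: le_trans; have := tS2 l; have := t0 l; lra.
Qed.

Lemma seq_param_lt j l : (j < l)%N -> t l <= t j / 2.
Proof. by move=> /seq_param_le /le_trans; apply. Qed.

Lemma seq_param_inj : injective t.
Proof.
have lt_neq j l : (j < l)%N -> t j <> t l.
  by move=> /seq_param_lt; have := t0 j; lra.
move=> j l tjl; have [jl|lj|//] := ltngtP j l.
  by case: (lt_neq _ _ jl).
by case: (lt_neq _ _ lj); rewrite tjl.
Qed.

Let dom : set R := 0 |` range t.

Lemma seq_param_small (e : R) : 0 < e ->
  exists J, forall j, (J <= j)%N -> t j < e.
Proof.
move=> /natSinv_lt[J Je]; exists J => j /seq_param_le /le_lt_trans; apply.
exact: le_lt_trans (t_inv J) Je.
Qed.

(** If a filter on [dom] does not cluster at 0, some neighbourhood of 0 misses one of its members,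
    so it lives on finitely many [t j]. *)
Lemma seq_dom_compact : compact dom.
Proof.
move=> F FF Fdom.
have [F0|] := pselect (cluster F 0); first by exists 0 => //; split => //; left.
move=> /existsNP[A] /existsNP[B] /not_implyP[FA] /not_implyP[B0 AB].
have /nbhs_ballP[e /= e0 eB] := B0.
have [J Je] := seq_param_small e0.
have Ffin : F (t @` `I_J).
  apply: filterS (filterI Fdom FA) => _ [[->|[j _ <-]] As].
    by exfalso; apply: AB; exists 0; split => //; exact: nbhs_singleton.
  exists j => //=; rewrite ltnNge; apply/negP => Jj.
  apply: AB; exists (t j); split => //; apply: eB.
  by rewrite /ball /= sub0r normrN gtr0_norm ?Je.
have /finite_compact : finite_set (t @` `I_J) by exact/finite_image/finite_II.
move=> /(_ F FF Ffin)[_ [[j _ <-] cj]].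
by exists (t j); split => //; right; exists j.
Qed.

(** The index picked by [cid] is the right one because [t] is injective; the default value [x]
    serves the parameter 0. *)
Let f (s : R) : X :=
  if pselect (exists j, s = t j) is left e then z (projT1 (cid e)) else x.

Let fx : f 0 = x.
Proof.
rewrite /f; case: pselect => // -[j t0j].
by have := t0 j; rewrite -t0j ltxx.
Qed.

Let fz j : f (t j) = z j.
Proof.
rewrite /f; case: pselect => [e|]; last by case; exists j.
by case: cid => l /= /seq_param_inj ->.
Qed.

Let bilip : exists2 L : R, 0 < L & forall s s' : dom,
  L^-1 * `|\val s - \val s'| <= mdist (f (\val s)) (f (\val s'))
    <= L * `|\val s - \val s'|.
Proof.
have H (s s' : R) : dom s -> dom s' ->
    a / 2 * `|s - s'| <= mdist (f s) (f s') <= 4 * b * `|s - s'|.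
  have zero j : a / 2 * `|0 - t j| <= mdist (f 0) (f (t j)) <= 4 * b * `|0 - t j|.
    rewrite sub0r normrN gtr0_norm// fx fz.
    have /andP[z1 z2] := xz j; apply/andP; split.
      by apply: le_trans z1; rewrite ler_pM2r// ler_pdivrMr// ler_pMr ?ler1n.
    by apply: (le_trans z2); rewrite ler_pM2r// ler_pMl ?ler1n.
  (* By [tS], [z l] is at most half as far from [x] as [z j] must be, so the triangle inequality
     leaves at least [a * t j / 2]. From above, [b * (t j + t l)] is compared with
     [t j - t l >= t j / 2]. *)
  have pos j l : (j < l)%N ->
      a / 2 * `|t j - t l| <= mdist (f (t j)) (f (t l)) <= 4 * b * `|t j - t l|.
    move=> jl; have tl2 := seq_param_lt jl.
    have btl : 2 * b * t l <= a * t j.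
      by apply: le_trans (tS j); rewrite ler_pM2l ?mulr_gt0// seq_param_le.
    have tjl : 0 <= t j - t l by have := t0 j; lra.
    rewrite ger0_norm// !fz; have /andP[j1 j2] := xz j; have /andP[l1 l2] := xz l.
    have at0 := mulr_gt0 a0 (t0 l).
    have btl2 : b * t l <= b * (t j / 2) by rewrite ler_pM2l.
    have bt0 := mulr_gt0 b0 (t0 l).
    have tri1 := metric_triangle (z j) x (z l).
    have tri2 := metric_triangle x (z l) (z j).
    rewrite (metric_sym (z l) (z j)) in tri2.
    rewrite (metric_sym (z j) x) in tri1.
    by apply/andP; split; lra.
  move=> [->|[j _ <-]] [->|[l _ <-]].
  - by rewrite subrr normr0 !mulr0 mdistxx lexx.
  - exact: zero.
  - by rewrite distrC metric_sym; exact: zero.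
  - have [jl|lj|->] := ltngtP j l.
    + exact: pos.
    + by rewrite distrC metric_sym; exact: pos.
    + by rewrite subrr normr0 !mulr0 mdistxx lexx.
have i0 : 0 < 2 / a by rewrite divr_gt0.
have b40 : 0 < 4 * b by rewrite mulr_gt0.
exists (2 / a + 4 * b); first exact: addr_gt0.
move=> s s'; have /andP[h1 h2] := H _ _ (set_valP s) (set_valP s').
apply/andP; split.
  apply: le_trans h1; rewrite ler_wpM2r// invf_ple ?posrE ?divr_gt0// ?addr_gt0//.
  by rewrite invf_div lerDl ltW.
by apply: (le_trans h2); rewrite ler_wpM2r// lerDr ltW.
Qed.

Let dom0 : dom !=set0. Proof. by exists 0; left. Qed.

Definition seq_fragment : fragment X := Fragment dom0 seq_dom_compact bilip.

Lemma seq_fragment_deriv n (phi : X -> 'rV[R]_n) (w : 'rV[R]_n) :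
  (forall e, 0 < e -> exists J, forall j, (J <= j)%N ->
     `|w - (t j)^-1 *: (phi (z j) - phi x)| <= e) ->
  exists s : fr_dom seq_fragment, seq_fragment s = x /\ fr_deriv phi s w.
Proof.
move=> wlim; have d0 : dom 0 by left.
pose s0 : fr_dom seq_fragment := exist _ 0 (mem_set d0).
exists s0; split; first exact: fx.
have fs0 : seq_fragment s0 = x := fx.
split.
  move=> B /nbhs_ballP[e /= e0 eB]; have [J Je] := seq_param_small e0.
  exists (t J); split; first by rewrite gt_eqF.
    by right; exists J.
  by apply: eB; rewrite /ball /= sub0r normrN gtr0_norm ?Je.
apply/cvgrPdist_le => e e0; have [J wJ] := wlim e e0.
apply/nbhs_ballP; exists (t J); first exact: t0.
move=> s ss0 ns0.
have : `|0 - \val s| < t J := ss0.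
have : fr_dom seq_fragment (\val s) by exact: set_valP.
have vs0 : \val s != 0.
  by apply: contra_neq ns0 => vs; apply: val_inj; rewrite vs.
have fs : seq_fragment s = f (\val s) by [].
move=> [vs|[j _ tj]]; first by rewrite vs eqxx in vs0.
rewrite sub0r normrN fs fs0 -tj gtr0_norm// => tjJ.
rewrite /= subr0 fz; apply: wJ; rewrite leqNgt; apply/negP => jJ.
by have := seq_param_lt jJ; have := t0 j; lra.
Qed.

End sequence_fragments.

(** Reachability near [u] gives points [y k] with difference quotients [w_ k] close to [u]. A sparse
    subsequence with quotients converging to some [w] near [u] carries a fragment through [x] with
    derivative [w]. *)
Lemma directions_dense (R : realType) (X : completeMetricType R) n
    (phi : X -> 'rV[R]_n) (x : X) : LIP phi ->
  (forall i, exists M, reach phi setT (rat_ball i) M x) ->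
  @sphere R n `<=` closure (directions phi x).
Proof.
move=> Lphi xr u u1 B uB; have [L L0 {}Lphi] := LIP_bound Lphi.
pose nrm (w : 'rV[R]_n) := (enorm w)^-1 *: w.
have eu0 : 0 < enorm u by rewrite u1.
have nrmu : nrm u = u by rewrite /nrm u1 invr1 scale1r.
have nrm_cont : {for u, continuous nrm}.
  apply: continuousZ; last exact: cvg_id.
  by apply: continuousV; [rewrite gt_eqF|exact: enorm_continuous].
have uB' : nbhs (nrm u) B by rewrite nrmu.
have /nbhs_ballP[e1 /= e10 e1B] := nrm_cont B uB'.
have := @cvgr_gt _ _ (nbhs u) _ _ _ (@enorm_continuous R n u) _ eu0.
move=> /(_ (nbhs_filter u)) /nbhs_ballP[e2 /= e20 e2B].
pose e := Num.min e1 e2.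
have e0 : 0 < e by rewrite lt_min e10.
have eB (w : 'rV[R]_n) : `|u - w| < e -> 0 < enorm w /\ B (nrm w).
  rewrite lt_min => /andP[w1 w2].
  by split; [apply: e2B|apply: e1B]; rewrite -ball_normE.
(* The zero vector has zero [enorm], so it is not within [e] of [u]. Hence the quotients satisfy
   [|w_ k| >= e / 2], which bounds the distances from [x] to [y k] from below. *)
have eu : e <= `|u|.
  rewrite leNgt; apply/negP => ue.
  have [] := eB 0; first by rewrite subr0.
  rewrite /enorm /dot big1 ?sqrtr0 ?ltxx// => j _.
  by rewrite mxE mul0r.
have e20' : 0 < e / 2 by rewrite divr_gt0.
have [i [_ iB]] := rat_ball_basis (nbhsx_ballx u _ e20').
have [M xM] := xr i.
(* The shift by [M.+2] puts every step strictly below the threshold [M.+1%:R^-1] of [xM]. *)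
pose s (k : nat) : R := (k + M.+2)%:R^-1.
have s0 k : 0 < s k by rewrite invr_gt0 ltr0n addnS.
have /choice[y yP] k : exists y, rat_ball i ((s k)^-1 *: (phi y - phi x)) /\
    mdist x y < M.+1%:R * s k.
  have sE : ratr (k + M.+2)%:R^-1 = s k by rewrite fmorphV rmorph_nat.
  have [||y [_]] := xM (k + M.+2)%:R^-1.
  - by rewrite invr_neq0// pnatr_eq0 addnS.
  - rewrite sE gtr0_norm// ltf_pV2 ?posrE ?ltr0n ?addnS// ltr_nat.
    by rewrite !ltnS leq_addl.
  by rewrite sE gtr0_norm// => yi xy; exists y.
pose w_ k := (s k)^-1 *: (phi (y k) - phi x).
have w_u k : `|u - w_ k| < e / 2.
  by have [/iB + _] := yP k; rewrite -ball_normE.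
have w_K : (w_ @ \oo) (closed_ball u (e / 2)).
  by exists 0%N => // k _ /=; rewrite closed_ballE//; exact: ltW (w_u k).
have [w [Kw clw]] := closed_ball_compact e20' (fmap_proper_filter w_ _) w_K.
have uw : `|u - w| <= e / 2 by move: Kw; rewrite closed_ballE.
have /choice[nx nxP] (p : nat * nat) :
    exists k, (p.1 <= k)%N /\ `|w - w_ k| < p.2.+1%:R^-1.
  have := clw [set w_ k | k in [set k | (p.1 <= k)%N]] (ball w p.2.+1%:R^-1).
  case.
  - by exists p.1 => // k /= pk; exists k.
  - by apply: nbhsx_ballx; rewrite invr_gt0.
  move=> _ [[k /= pk <-] wk]; exists k; split => //.
  by move: wk; rewrite -ball_normE.
have [ewgt0 Bw] : 0 < enorm w /\ B (nrm w).
  by apply: eB; rewrite (le_lt_trans uw)// ltr_pdivrMr// ltr_pMr ?ltr1n.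
(* The lower constant comes from [e / 2 * s k <= |phi (y k) - phi x| <= L * mdist x (y k)], the
   upper one from the speed bound in [reach]. *)
pose a := e / 2 / L; pose b : R := M.+1%:R.
have a0 : 0 < a by rewrite divr_gt0.
have b0 : 0 < b by rewrite ltr0n.
(* [K] is at least 2 and at least [2 * b / a]. Consecutive chosen steps shrink by the factor [K] or
   more, which yields both decay conditions [tS2] and [tS]. *)
pose K := (Num.truncn (2 * b / a)).+2.
pose sg := fix sg j :=
  if j is j'.+1 then nx (K * (sg j' + M.+2), j)%N else nx (0, 0)%N.
have sgw j : `|w - w_ (sg j)| < j.+1%:R^-1.
  by case: j => [|j] /=; [exact: (nxP (0, 0)%N).2|exact: (nxP (_, j.+1)%N).2].
have sgS j : (K * (sg j + M.+2) <= sg j.+1)%N by exact: (nxP (_, j.+1)%N).1.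
have sg_ge j : (j <= sg j)%N.
  elim: j => // j IH; apply: leq_trans (sgS j); rewrite /K mulSn.
  by rewrite (leq_trans _ (leq_addr _ _))// addnS ltnS (leq_trans IH)// leq_addr.
have KtS j : K%:R * s (sg j.+1) <= s (sg j).
  rewrite /s ler_pdivrMr ?ltr0n ?addnS// ler_pdivlMl ?ltr0n ?addnS//.
  rewrite mulrC -natrM ler_nat -!addnS.
  exact: leq_trans (sgS j) (leq_addr _ _).
have tS2 j : s (sg j.+1) <= s (sg j) / 2.
  rewrite ler_pdivlMr// mulrC; apply: le_trans (KtS j).
  by rewrite ler_wpM2r ?(ltW (s0 _))// ler_nat.
have tS j : 2 * b * s (sg j.+1) <= a * s (sg j).
  apply: (@le_trans _ _ (a * (K%:R * s (sg j.+1)))); last by rewrite ler_pM2l.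
  rewrite mulrA ler_wpM2r ?(ltW (s0 _))// -ler_pdivrMl// mulrC.
  by rewrite (le_trans (ltW (truncnS_gt _)))// ler_nat.
have t_inv j : s (sg j) <= j.+1%:R^-1.
  rewrite lef_pV2 ?posrE ?ltr0n ?addnS// ler_nat ltnS.
  by rewrite (leq_trans (sg_ge j))// -addnS leq_addr.
have xz j : a * s (sg j) <= mdist x (y (sg j)) <= b * s (sg j).
  apply/andP; split; last by case: (yP (sg j)) => _ /ltW.
  rewrite /a mulrAC ler_pdivrMr// mulrC [leRHS]mulrC.
  rewrite metric_sym (le_trans _ (Lphi _ _))//.
  have : e / 2 <= `|w_ (sg j)|.
    have := ler_normD (u - w_ (sg j)) (w_ (sg j)); rewrite subrK.
    by have := w_u (sg j); lra.
  rewrite /w_ normrZ normfV gtr0_norm// ler_pdivlMl//.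
have [|st [stx dst]] := seq_fragment_deriv (n := n) (phi := phi) (w := w)
  a0 b0 (fun j => s0 (sg j)) tS2 tS t_inv xz.
  move=> r /natSinv_lt[J Jr]; exists J => j Jj.
  rewrite -/(w_ (sg j)) ltW// (lt_trans _ Jr)// (lt_le_trans (sgw j))//.
  by rewrite lef_pV2 ?posrE// ler_nat.
exists (nrm w); split => //.
exists (seq_fragment a0 b0 (fun j => s0 (sg j)) tS2 tS t_inv xz), st, w; split => //.
apply/eqP => w0; move: ewgt0; rewrite w0 /enorm /dot big1 ?sqrtr0 ?ltxx// => j _.
by rewrite mxE mul0r.
Qed.

Theorem theorem1p3 (R : realType) (X : completeMetricType R)
  (X_separable : separable X)
  (mu : {measure set (borel X) -> \bar R})
  (mu_finite : finite_on_bounded mu)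
  (n : nat) (U : set X) (phi : X -> 'rV[R]_n)
  (chart : fragmentwise_chart mu U phi) :
  {ae mu, forall x, U x -> @sphere R n `<=` closure (directions phi x)}.
Proof.
have [_ Lphi [mU [A [C [indC dirC]]]] _] := chart.
have cphi := LIP_continuous Lphi.
(* Bounded pieces exhausting [U]: their finite measure is what [maximal_subset] requires. *)
pose W (N : nat) : set (borel X) := U `&` ball (point : X) N%:R.
have mW N : measurable (W N).
  by apply: measurableI => //; apply: measurable_open; exact: metric_ball_open.
have Wfin N : (mu (W N) < +oo)%E by apply: (mu_finite (W N) (point : X) N%:R) => // y [].
have W0 N i : mu (W N `\` \bigcup_M reach phi setT (rat_ball i) M) = 0%E.
  have /choice[Z ZP] m := maximal_subset (mW N) (Wfin N)
    (null_deriv0 phi (rat_ball m)) (@null_deriv_bigcup _ _ _ phi (rat_ball m)).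
  have mZ m : measurable (Z m) by case: (ZP m).
  have nZ m : null_deriv phi (rat_ball m) (Z m) by case: (ZP m).
  apply: (unreachable_null (mW N) mZ cphi _ indC) => [m|j].
    by case: (ZP m).
  have := cone_null_null (mW N) mZ nZ (dirC j).
  (* [cone_null] lies in [W N], hence in [U], so [mu] and its restriction to [U] agree on it. *)
  rewrite /mrestr => <-; congr (mu _); apply/seteqP; split => [y yN|y []//].
  by split => //; case: yN => -[].
have : mu.-negligible (\bigcup_N \bigcup_i
    (W N `\` \bigcup_M reach phi setT (rat_ball i) M)).
  apply: negligible_bigcup_countType => N.
  apply: negligible_bigcup_countType => i; apply/negligibleP; last exact: W0.
  apply: measurableD => //; apply: bigcupT_measurable => M.
  by apply: measurable_reach => //; exact: rat_ball_open.
apply: negligibleS => x /= /not_implyP[Ux ndense].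
have [i ni] : exists i, ~ exists M, reach phi setT (rat_ball i) M x.
  apply: contrapT => /forallNP H; apply: ndense.
  by apply: directions_dense => // i; apply: contrapT; exact: H.
exists (Num.truncn (mdist (point : X) x)).+1 => //; exists i => //; split.
  by split => //; rewrite ballEmdist /= truncnS_gt.
by move=> [M _ xM]; apply: ni; exists M.
Qed.
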